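(* Let $\vdash$ be an equivalential finitary logic with a partition function, and let $\langle\mathbf{A},F\rangle$ be a matrix. The following are equivalent: (i) $\langle\mathbf{A},F\rangle\in\mathsf{Mod}^{\mathrm{Su}}(\vdash^{l})$; (ii) there is a directed system of matrices $X=\langle\langle I,\le\rangle,\{\langle\mathbf{A}_i,F_i\rangle\}_{i\in I},\{f_{ij}:i\le j\}\rangle$ with all $\langle\mathbf{A}_i,F_i\rangle\in\mathsf{Mod}^{*}(\vdash)$ such that $\langle\mathbf{A},F\rangle=\mathrm{PL}(X)$ and, for all $n,i\in I$ such that $\langle\mathbf{A}_n,F_n\rangle$ is trivial (i.e. $F_n=A_n$) and $n<i$, there exists $j\in I$ with $n\le j$, $i\not\le j$ and $\mathbf{A}_j$ non-trivial (i.e. $|A_j|>1$).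
   Context: Fix an algebraic language without constant symbols; $\mathrm{Var}(\varphi)$ is the set of variables of $\varphi$. A logic is a substitution-invariant consequence relation; finitary if every consequence follows from a finite subset of premises. The left variable inclusion companion: $\Gamma\vdash^{l}\varphi$ iff there is $\Gamma'\subseteq\Gamma$ with $\bigcup_{\gamma\in\Gamma'}\mathrm{Var}(\gamma)\subseteq\mathrm{Var}(\varphi)$ and $\Gamma'\vdash\varphi$. A matrix $\langle\mathbf{A},F\rangle$ is a model of a logic if $\Gamma\vdash\varphi$ and $h[\Gamma]\subseteq F$ (homomorphism $h$ from the formula algebra) imply $h(\varphi)\in F$; $F$ is then a filter. $\Omega^{\mathbf{A}}F$ is the largest congruence compatible with $F$; the Suszko congruence w.r.t. a logic is the intersection of $\Omega^{\mathbf{A}}G$ over filters $G\supseteq F$ of that logic. $\mathsf{Mod}^{*}(\vdash)$ (resp. $\mathsf{Mod}^{\mathrm{Su}}(\vdash)$) is the class of models of $\vdash$ whose Leibniz (resp. Suszko) congruence is the identity; $\mathrm{Alg}(\vdash)$ is the class of algebraic reducts of $\mathsf{Mod}^{\mathrm{Su}}(\vdash)$. $\vdash$ is equivalential if there is a set of formulas $\Delta(x,y)$ such that for every model $\langle\mathbf{A},F\rangle$ and $a,b\in A$: $\langle a,b\rangle\in\Omega^{\mathbf{A}}F$ iff $\Delta^{\mathbf{A}}(a,b)\subseteq F$. A binary operation $\cdot$ is a partition function on $\mathbf{A}$ if for all $a,b,c$ and basic operations $g$ of arity $n\ge1$: $a\cdot a=a$; $a\cdot(b\cdot c)=(a\cdot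 b)\cdot c$; $a\cdot(b\cdot c)=a\cdot(c\cdot b)$; $g(a_1,\dots,a_n)\cdot b=g(a_1\cdot b,\dots,a_n\cdot b)$; $b\cdot g(a_1,\dots,a_n)=b\cdot a_1\cdot\ldots\cdot a_n$; $\vdash$ has a partition function if some formula $x\cdot y$ in which both $x,y$ occur satisfies $x\vdash x\cdot y$ and is a partition function on every $\mathbf{A}\in\mathrm{Alg}(\vdash)$. A directed system of matrices: semilattice $\langle I,\vee\rangle$ (order $i\le j$ iff $i\vee j=j$), matrices $\langle\mathbf{A}_i,F_i\rangle$ with pairwise disjoint universes, homomorphisms $f_{ij}\colon\mathbf{A}_i\to\mathbf{A}_j$ ($i\le j$) with $f_{ij}[F_i]\subseteq F_j$, $f_{ii}=\mathrm{id}$, $f_{ik}=f_{jk}\circ f_{ij}$; its Płonka sum $\mathrm{PL}(X)$ is $\langle\mathbf{B},\bigcup_iF_i\rangle$, $\mathbf{B}$ with universe $\bigcup_iA_i$ and $f^{\mathbf{B}}(a_1,\dots,a_n)=f^{\mathbf{A}_j}(f_{i_1j}(a_1),\dots,f_{i_nj}(a_n))$ for $a_k\in A_{i_k}$, $j=i_1\vee\dots\vee i_n$. *)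

(* Defs.v *)
From mathcomp Require Import all_boot all_order.
From mathcomp Require Import boolp classical_sets cardinality.
From Stdlib Require Import RelationClasses Relation_Operators.

Set Implicit Arguments.
Unset Strict Implicit.
Unset Printing Implicit Defensive.

Import Order.TTheory.
Local Open Scope classical_set_scope.
Local Open Scope order_scope.

Record language := Language {
  symbol : Type;
  arity : symbol -> nat;
  arity_gt0 : forall g, (0 < arity g)%N
}.

Record algebra (L : language) := Algebra {
  carrier :> Type;
  op : forall g : symbol L, ('I_(arity g) -> carrier) -> carrier;
  carrier_inhabited : inhabited carrier
}.

Definition is_hom (L : language) (A B : algebra L) (h : A -> B) : Prop :=
  forall (g : symbol L) (a : 'I_(arity g) -> A), h (op a) = op (h \o a).

Inductive formula (L : language) :=
| Var of nat
| App (g : symbol L) of ('I_(arity g) -> formula L).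

Arguments Var {L} _.

Definition Fm (L : language) : algebra L :=
  @Algebra L (formula L) (@App L) (inhabits (Var 0)).

Fixpoint vars (L : language) (t : formula L) : set nat :=
  match t with
  | Var x => [set x]
  | App g ts => \bigcup_k vars (ts k)
  end.

Fixpoint eval (L : language) (A : algebra L) (v : nat -> A) (t : formula L) : A :=
  match t with
  | Var x => v x
  | App g ts => op (fun k => eval v (ts k))
  end.

(* [Var 0] and [Var 1] play the roles of x and y in a formula t(x, y); the
   value is only meaningful when [vars t `<=` [set 0; 1]]. *)
Definition eval2 (L : language) (A : algebra L) (t : formula L) (a b : A) : A :=
  eval (fun x => if x == 0%N then a else b) t.

Definition conseq (L : language) := set (formula L) -> formula L -> Prop.

Definition is_logic (L : language) (C : conseq L) : Prop :=
  [/\ forall (G : set (formula L)) phi, G phi -> C G phi,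
      forall (G D : set (formula L)) phi,
        (forall psi, D psi -> C G psi) -> C D phi -> C G phi
    & forall (s : Fm L -> Fm L), is_hom s ->
        forall (G : set (formula L)) phi, C G phi -> C (s @` G) (s phi)].

Definition finitary (L : language) (C : conseq L) : Prop :=
  forall (G : set (formula L)) phi, C G phi ->
    exists G' : set (formula L), [/\ finite_set G', G' `<=` G & C G' phi].

Definition left_companion (L : language) (C : conseq L) : conseq L :=
  fun G phi => exists G' : set (formula L),
    [/\ G' `<=` G, \bigcup_(gamma in G') vars gamma `<=` vars phi & C G' phi].

Record lmatrix (L : language) := LMatrix {
  alg :> algebra L;
  filt : set alg
}.

Arguments filt {L} _ _.

Definition is_model (L : language) (C : conseq L) (M : lmatrix L) : Prop :=
  forall (G : set (formula L)) phi, C G phi ->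
  forall h : Fm L -> M, is_hom h -> h @` G `<=` filt M -> filt M (h phi).

Definition is_filter (L : language) (C : conseq L) (A : algebra L) (F : set A) :=
  is_model C (LMatrix F).

Definition congruence (L : language) (A : algebra L) (R : A -> A -> Prop) : Prop :=
  Equivalence R /\
  forall (g : symbol L) (a b : 'I_(arity g) -> A),
    (forall k, R (a k) (b k)) -> R (op a) (op b).

Definition compatible (L : language) (A : algebra L) (F : set A)
    (R : A -> A -> Prop) : Prop :=
  forall a b, R a b -> F a -> F b.

(* The union of all compatible congruences; [leibniz_largest] below shows that
   it is the largest compatible congruence. *)
Definition leibniz (L : language) (A : algebra L) (F : set A) (a b : A) : Prop :=
  exists R : A -> A -> Prop, [/\ congruence R, compatible F R & R a b].

Section LeibnizLargest.
Variables (L : language) (A : algebra L) (F : set A).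

Let T := clos_refl_sym_trans A (leibniz F).

Let upd n (c : 'I_n -> A) (k : 'I_n) (x : A) : 'I_n -> A :=
  fun l => if l == k then x else c l.

Let T_op1 (g : symbol L) (c : 'I_(arity g) -> A) k x y :
  T x y -> T (op (upd c k x)) (op (upd c k y)).
Proof.
elim=> [{}x {}y [R [[eqR opR] FR Rxy]]|z|{}x {}y _ Tyx|{}x {}y z _ Txy _ Tyz].
apply: rst_step; exists R; split=> //.
by apply: opR => l; rewrite /upd; case: ifP => // _; exact: Equivalence_Reflexive.
- exact: rst_refl.
- exact: rst_sym Tyx.
- exact: rst_trans Txy Tyz.
Qed.

Let T_congruence : congruence T.
Proof.
split.
  split=> [x|x y|x y z]; [exact: rst_refl|exact: rst_sym|exact: rst_trans].
move=> g a b ab.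
pose c m : 'I_(arity g) -> A := fun l => if (l < m)%N then b l else a l.
have Tc m : (m <= arity g)%N -> T (op (c 0%N)) (op (c m)).
  elim: m => [_|m IH lt_m]; first exact: rst_refl.
  apply: rst_trans (IH (ltnW lt_m)) _.
  pose k := Ordinal lt_m.
  have -> : c m = upd (c m) k (a k).
    by apply/funext => l; rewrite /upd; case: eqP => // ->; rewrite /c ltnn.
  have -> : c m.+1 = upd (c m) k (b k).
    apply/funext => l; rewrite /upd; case: eqP => [-> | lk]; first by rewrite /c ltnSn.
    by rewrite /c ltnS leq_eqVlt; case: eqP => // lm; case: lk; exact: val_inj.
  exact: T_op1.
have := Tc _ (leqnn _).
have -> : c 0%N = a by apply/funext.
by have -> : c (arity g) = b by apply/funext => l; rewrite /c ltn_ord.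
Qed.

Let T_compatible : compatible F T.
Proof.
suff H a b : T a b -> (F a <-> F b) by move=> a b /H [].
elim=> [x y [R [[eqR opR] FR Rxy]]|//|x y _ [? ?] //|x y z _ [? ?] _ [? ?]].
  by split; apply: FR => //; exact: Equivalence_Symmetric.
by split; auto.
Qed.

Lemma leibniz_largest :
  [/\ congruence (leibniz F), compatible F (leibniz F)
    & forall R : A -> A -> Prop, congruence R -> compatible F R ->
        forall a b, R a b -> leibniz F a b].
Proof.
have -> : leibniz F = T.
  apply/funext => a; apply/funext => b; apply/propext; split=> [|Tab].
    exact: rst_step.
  by exists T.
split=> // R cR FR a b Rab; apply: rst_step; by exists R.
Qed.

End LeibnizLargest.

Definition suszko (L : language) (C : conseq L) (A : algebra L) (F : set A)
    (a b : A) : Prop :=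
  forall G : set A, is_filter C G -> F `<=` G -> leibniz G a b.

Definition ModStar (L : language) (C : conseq L) (M : lmatrix L) : Prop :=
  is_model C M /\ forall a b : M, leibniz (filt M) a b <-> a = b.

Definition ModSu (L : language) (C : conseq L) (M : lmatrix L) : Prop :=
  is_model C M /\ forall a b : M, suszko C (filt M) a b <-> a = b.

Definition Alg (L : language) (C : conseq L) (A : algebra L) : Prop :=
  exists F : set A, ModSu C (LMatrix F).

Definition equivalential (L : language) (C : conseq L) : Prop :=
  exists Delta : set (formula L),
    (forall delta, Delta delta -> vars delta `<=` [set 0%N; 1%N]) /\
    forall M : lmatrix L, is_model C M -> forall a b : M,
      leibniz (filt M) a b <->
      [set eval2 delta a b | delta in Delta] `<=` filt M.

Definition is_partition_function (L : language) (A : algebra L)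
    (dot : A -> A -> A) : Prop :=
  [/\ forall a, dot a a = a,
      forall a b c, dot a (dot b c) = dot (dot a b) c,
      forall a b c, dot a (dot b c) = dot a (dot c b),
      forall (g : symbol L) (a : 'I_(arity g) -> A) b,
        dot (op a) b = op (fun k => dot (a k) b)
    & forall (g : symbol L) (a : 'I_(arity g) -> A) b,
        dot b (op a) = foldl dot b [seq a k | k <- enum 'I_(arity g)]].

Definition has_partition_function (L : language) (C : conseq L) : Prop :=
  exists t : formula L,
    [/\ vars t = [set 0%N; 1%N],
        C [set Var 0] t
      & forall A : algebra L, Alg C A -> is_partition_function (@eval2 L A t)].

Record directed_system (L : language) (d : Order.disp_t)
    (I : joinSemilatticeType d) := DirectedSystem {
  component :> I -> lmatrix L;
  index_inhabited : inhabited I;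
  trans_map : forall i j : I, i <= j -> component i -> component j;
  trans_map_hom : forall (i j : I) (ij : i <= j), is_hom (trans_map ij);
  trans_map_filt : forall (i j : I) (ij : i <= j),
    trans_map ij @` filt (component i) `<=` filt (component j);
  trans_map_id : forall (i : I) (ii : i <= i) a, trans_map ii a = a;
  trans_map_comp : forall (i j k : I) (ij : i <= j) (jk : j <= k) (ik : i <= k) a,
    trans_map ik a = trans_map jk (trans_map ij a)
}.

Section FiniteJoin.
Variables (d : Order.disp_t) (I : joinSemilatticeType d).

(* The join of a nonempty finite family.  [I] need not have a bottom element,
   so the iteration starts from the first member, which does not change the
   join. *)
Definition join_fam (n : nat) (n_gt0 : (0 < n)%N) (u : 'I_n -> I) : I :=
  \big[Order.join/u (Ordinal n_gt0)]_(k < n) u k.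

Lemma le_join_fam n (n_gt0 : (0 < n)%N) (u : 'I_n -> I) k :
  u k <= join_fam n_gt0 u.
Proof.
rewrite /join_fam; have: k \in index_enum 'I_n by rewrite mem_index_enum.
elim: (index_enum _) => // x s IH; rewrite inE big_cons.
by case/orP => [/eqP -> | /IH ks]; [exact: leUl | exact: lexUr].
Qed.

Lemma join_fam_le n (n_gt0 : (0 < n)%N) (u : 'I_n -> I) j :
  (forall k, u k <= j) -> join_fam n_gt0 u <= j.
Proof.
by move=> uj; rewrite /join_fam; elim/big_rec: _ => // k x _ xj; rewrite leUx uj.
Qed.

End FiniteJoin.

(* The universes are made disjoint by taking their tagged union. *)
Section PlonkaSum.
Variables (L : language) (d : Order.disp_t) (I : joinSemilatticeType d).
Variable X : directed_system L I.

Definition plonka_op (g : symbol L) (a : 'I_(arity g) -> {i : I & X i}) :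
    {i : I & X i} :=
  existT (fun i : I => X i) (join_fam (arity_gt0 g) (fun k => tag (a k)))
    (op (fun k => trans_map (le_join_fam (arity_gt0 g) (fun k => tag (a k)) k)
                            (tagged (a k)))).

Fact plonka_inhabited : inhabited {i : I & X i}.
Proof.
by case: (index_inhabited X) => i; case: (carrier_inhabited (X i)) => a; exists; exists i.
Qed.

Definition plonka_algebra : algebra L := Algebra plonka_op plonka_inhabited.

Definition plonka_sum : lmatrix L :=
  @LMatrix L plonka_algebra [set a | filt (X (tag a)) (tagged a)].

End PlonkaSum.

Definition matrix_iso (L : language) (M N : lmatrix L) : Prop :=
  exists h : M -> N,
    [/\ is_hom h, bijective h & forall a, filt M a <-> filt N (h a)].

Definition trivial_matrix (L : language) (M : lmatrix L) : Prop :=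
  filt M = [set: M].

Definition nontrivial_algebra (L : language) (A : algebra L) : Prop :=
  exists a b : A, a <> b.

(* Main.v *)
Require Import Defs.
From HB Require Import structures.
From mathcomp Require Import all_boot all_order.
From mathcomp Require Import boolp classical_sets cardinality.

(* Let [x . y] be the partition function.  In a model of [C] each value of
   [delta(a . b, a)], for [delta] in [Delta], is [delta(a, a)] or
   [delta(a, a) . b], hence lies in the filter: so [x . y = x] holds in every
   reduced model of [C].

   (ii) implies (i): two elements of one fiber are separated by the filter [F]
   of the sum itself.  If [x] in the fiber [n] and its image in the fiber
   [k > n] were identified by the Suszko congruence, then so would be [z . x]
   and its image above [k], for every [z]; enlarging [F] by all fibers above [k]
   and choosing [z] outside [F] in a fiber above [n] but not above [k] excludes
   this.

   (i) implies (ii): an identity that holds in the reduced models of [C] and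
   has the same variables on both sides holds in the Suszko-reduced models of
   the companion, so [x . y] decomposes such a model into a Plonka sum.  By
   finitarity its fibers are models of [C], and [Delta] shows that they are
   reduced, because the Leibniz congruences of a filter on the fibers glue to a
   compatible congruence of the whole algebra.  Were the condition on trivial
   fibers to fail, the element of a trivial matrix would be identified with its
   image in a higher fiber. *)

Set Implicit Arguments.
Unset Strict Implicit.
Unset Printing Implicit Defensive.

Import Order.TTheory.
Local Open Scope classical_set_scope.

(** * Substitutions, models and the Leibniz congruence *)

Section Formulas.
Variable L : language.
Implicit Types (A B : algebra L) (phi psi : formula L).

Lemma eval_hom A (v : nat -> A) : is_hom (eval v : Fm L -> A).
Proof. by []. Qed.

Lemma hom_eval A B (h : A -> B) : is_hom h ->
  forall (v : nat -> A) phi, h (eval v phi) = eval (h \o v) phi.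
Proof.
move=> hom_h v; elim=> [//|g ts IH] /=.
by rewrite hom_h; congr op; apply/funext => k /=.
Qed.

Lemma eval_Var phi : eval (Var : nat -> Fm L) phi = phi.
Proof. by elim: phi => [//|g ts IH] /=; congr App; apply/funext. Qed.

Lemma homE A (h : Fm L -> A) : is_hom h -> h = eval (h \o Var).
Proof.
by move=> hom_h; apply/funext => phi; rewrite -hom_eval // eval_Var.
Qed.

Lemma eval_subst A (v : nat -> A) (s : nat -> Fm L) phi :
  eval v (eval s phi) = eval (eval v \o s) phi.
Proof. exact: (hom_eval (@eval_hom A v)). Qed.

Lemma eq_eval A (v w : nat -> A) phi :
  (forall x, vars phi x -> v x = w x) -> eval v phi = eval w phi.
Proof.
elim: phi => [x|g ts IH] /= vw; first exact: vw.
by congr op; apply/funext => k; apply: IH => x xk; apply: vw; exists k.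
Qed.

Lemma vars_subst (s : nat -> Fm L) phi :
  vars (eval s phi) = \bigcup_(x in vars phi) vars (s x).
Proof.
elim: phi => [x|g ts IH] /=; first by rewrite bigcup_set1.
apply/seteqP; split=> y.
  by move=> [k _]; rewrite IH => -[x xk xy]; exists x => //; exists k.
by move=> [x [k _ xk] xy]; exists k => //; rewrite IH; exists x.
Qed.

Lemma vars_nonempty phi : vars phi !=set0.
Proof.
elim: phi => [x|g ts IH] /=; first by exists x.
have [x xk] := IH (Ordinal (arity_gt0 g)).
by exists x; exists (Ordinal (arity_gt0 g)).
Qed.

Lemma finite_vars phi : finite_set (vars phi).
Proof.
elim: phi => [x|g ts IH] /=; first exact: finite_set1.
by apply: bigcup_finite => // ; exact: finite_finset.
Qed.

Lemma hom_eval2 A B (h : A -> B) (t : formula L) a b : is_hom h ->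
  h (eval2 t a b) = eval2 t (h a) (h b).
Proof.
move=> hom_h; rewrite /eval2 hom_eval //; apply: eq_eval => x _ /=.
by case: ifP.
Qed.

Lemma eval_eval2 A (v : nat -> A) (t phi psi : formula L) :
  eval v (eval2 (A := Fm L) t phi psi) = eval2 t (eval v phi) (eval v psi).
Proof. exact: (@hom_eval2 (Fm L) A (eval v) t phi psi (@eval_hom A v)). Qed.

Lemma vars_eval2 (t phi psi : formula L) : vars t = [set 0%N; 1%N] ->
  vars (eval2 (A := Fm L) t phi psi) = vars phi `|` vars psi.
Proof.
by move=> tE; rewrite /eval2 vars_subst tE bigcup_setU !bigcup_set1.
Qed.

Lemma modelP (C : conseq L) (M : lmatrix L) : is_model C M <->
  forall G phi, C G phi -> forall v : nat -> M,
    (forall psi, G psi -> filt M (eval v psi)) -> filt M (eval v phi).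
Proof.
split=> [mM G phi CG v GF|mM G phi CG h hom_h].
  by apply: (mM _ _ CG (eval v)) => // _ [psi Gpsi <-]; exact: GF.
rewrite (homE hom_h) => GF; apply: mM CG _ _ => psi Gpsi.
by apply: GF; exists psi.
Qed.

Lemma leibniz_congruence A (F : set A) : congruence (leibniz F).
Proof. by case: (leibniz_largest F). Qed.

Lemma leibniz_refl A (F : set A) a : leibniz F a a.
Proof. by have [[+ _ _] _] := leibniz_congruence F; apply. Qed.

Lemma leibniz_sym A (F : set A) a b : leibniz F a b -> leibniz F b a.
Proof. by have [[_ + _] _] := leibniz_congruence F; apply. Qed.

Lemma leibniz_trans A (F : set A) a b c :
  leibniz F a b -> leibniz F b c -> leibniz F a c.
Proof. by have [[_ _ +] _] := leibniz_congruence F; apply. Qed.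

Lemma leibniz_filt A (F : set A) a b : leibniz F a b -> F a -> F b.
Proof. by case: (leibniz_largest F) => _ + _; apply. Qed.

Lemma congruence_eval A (R : A -> A -> Prop) (v w : nat -> A) phi :
  congruence R -> (forall x, vars phi x -> R (v x) (w x)) ->
  R (eval v phi) (eval w phi).
Proof.
move=> [_ opR]; elim: phi => [x|g ts IH] /= vw; first exact: vw.
by apply: opR => k; apply: IH => x xk; apply: vw; exists k.
Qed.

Lemma leibniz_total A (a b : A) : leibniz [set: A] a b.
Proof. by exists (fun _ _ => True); split. Qed.

Lemma leibniz_preim A B (h : A -> B) (H : set B) a b : is_hom h ->
  leibniz H (h a) (h b) -> leibniz (h @^-1` H) a b.
Proof.
move=> hom_h hab; exists (fun x y => leibniz H (h x) (h y)).
split=> //; last by move=> x y; exact: leibniz_filt.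
split; first split.
- by move=> x; exact: leibniz_refl.
- by move=> x y; exact: leibniz_sym.
- by move=> x y z; exact: leibniz_trans.
move=> g x y xy; rewrite !hom_h.
by have [_] := leibniz_congruence H; apply.
Qed.

Lemma ModStar_trivial C (M : lmatrix L) :
  ModStar C M -> trivial_matrix M -> forall a b : M, a = b.
Proof. by move=> [_ redM] MT a b; apply/redM; rewrite MT; exact: leibniz_total. Qed.

(* With the variable 0 as argument and [w] supplying the parameters, [phi]
   defines a unary polynomial of [A]. *)
Section Polynomials.
Variables (A : algebra L) (G : set A).

Let at0 (w : nat -> A) a x := if x == 0%N then a else w x.

Let R a b := forall phi w, G (eval (at0 w a) phi) <-> G (eval (at0 w b) phi).

Let upd n (c : 'I_n -> A) (k : 'I_n) (x : A) : 'I_n -> A :=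
  fun l => if l == k then x else c l.

Let R_op1 (g : symbol L) (c : 'I_(arity g) -> A) k x y :
  R x y -> R (op (upd c k x)) (op (upd c k y)).
Proof.
move=> Rxy phi w; pose n := arity g.
(* [s] puts at variable 0 the operation with its hole kept as [Var 0] and its other arguments as
   [Var l.+1], and shifts the remaining variables of [phi] by [n]. [u] supplies the values; its
   value at 0 is overridden by [at0]. *)
pose s m : Fm L := if m is m'.+1 then Var (n + m').+1 else
  App (fun l : 'I_n => if l == k then Var 0 else Var l.+1).
pose u m : A := if m is m'.+1 then
  if insub m' is Some l then c l else w (m' - n).+1 else w 0.
have E z : eval (at0 w (op (upd c k z))) phi = eval (at0 u z) (eval s phi).
  rewrite eval_subst; apply: eq_eval => -[_|m _] /=; rewrite /at0 /=.
    congr op; apply/funext => l; rewrite /upd; case: eqP => //= _.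
    by rewrite valK.
  by rewrite insubN ?addKn // -leqNgt leq_addr.
by rewrite !E; exact: Rxy.
Qed.

(** Agreement under all unary polynomials is a congruence, and the polynomial [Var 0] makes it
    compatible with [G]. *)
Lemma leibniz_polynomial a b :
  (forall phi w, G (eval (fun x => if x == 0%N then a else w x) phi) <->
                 G (eval (fun x => if x == 0%N then b else w x) phi)) ->
  leibniz G a b.
Proof.
move=> Rab; exists R; split=> //; last by move=> x y /(_ (Var 0) (fun=> x)) [].
split.
  split=> [x //|x y Rxy phi w|x y z Rxy Ryz phi w].
    by split=> /Rxy.
  by split=> [/Rxy /Ryz|/Ryz /Rxy].
move=> g x y xy.
(* The arguments are changed one at a time: [c m] has the first [m] of them already replaced. *)
pose c m : 'I_(arity g) -> A := fun l => if (l < m)%N then y l else x l.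
have Rc m : (m <= arity g)%N -> R (op (c 0%N)) (op (c m)).
  elim: m => [_ //|m IH lt_m] phi w; rewrite (IH (ltnW lt_m)).
  pose k := Ordinal lt_m.
  have -> : c m = upd (c m) k (x k).
    by apply/funext => l; rewrite /upd; case: eqP => // ->; rewrite /c ltnn.
  have -> : c m.+1 = upd (c m) k (y k).
    apply/funext => l; rewrite /upd; case: eqP => [->|lk]; first by rewrite /c ltnSn.
    by rewrite /c ltnS leq_eqVlt; case: eqP => // lm; case: lk; exact: val_inj.
  exact: R_op1.
have := Rc _ (leqnn _).
have -> : c 0%N = x by apply/funext.
by have -> : c (arity g) = y by apply/funext => l; rewrite /c ltn_ord.
Qed.

End Polynomials.

End Formulas.

(** * The reduction of a matrix *)

Section LeibnizQuotient.
Variables (L : language) (M : lmatrix L).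

Let R := leibniz (filt M).

(** Classes are sets of elements of [M], so that equality of classes is the Leibniz congruence
    itself. *)
Definition leibniz_class := {p : set M | exists a, p = R a}.

Definition to_class (a : M) : leibniz_class := exist _ (R a) (ex_intro _ a erefl).

Definition class_repr (p : leibniz_class) : M := sval (cid (svalP p)).

Lemma class_reprK p : to_class (class_repr p) = p.
Proof.
rewrite /class_repr; case: (cid _) => a /= pa; case: p pa => p pP /= pa.
exact: eq_exist.
Qed.

Lemma eq_to_class a b : to_class a = to_class b <-> R a b.
Proof.
split=> [/(congr1 sval)/= abE|ab]; first by rewrite abE; exact: leibniz_refl.
apply: eq_exist; apply/funext => c; apply/propext; split.
  exact/leibniz_trans/leibniz_sym.
exact: leibniz_trans.
Qed.

Definition leibniz_quotient_alg : algebra L :=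
  @Algebra L leibniz_class (fun g a => to_class (op (class_repr \o a)))
    (let: inhabits a := carrier_inhabited M in inhabits (to_class a)).

Definition leibniz_quotient : lmatrix L :=
  @LMatrix L leibniz_quotient_alg [set p | filt M (class_repr p)].

Lemma to_class_hom : is_hom (to_class : M -> leibniz_quotient).
Proof.
move=> g a; apply/eq_to_class; have [_ opR] := leibniz_congruence (filt M).
apply: opR => k /=; apply/eq_to_class; exact/esym/class_reprK.
Qed.

Lemma filt_to_class a : filt leibniz_quotient (to_class a) <-> filt M a.
Proof.
have ra : R (class_repr (to_class a)) a by apply/eq_to_class; exact: class_reprK.
by split; apply: leibniz_filt => //; exact: leibniz_sym.
Qed.

(** Valuations lift through representatives, and the Leibniz congruence of the quotient pulls back
    into that of [M]. *)
Lemma leibniz_quotient_ModStar C : is_model C M -> ModStar C leibniz_quotient.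
Proof.
move=> /modelP mM; split.
  apply/modelP => G phi CG v GF.
  have vE : v = to_class \o (class_repr \o v).
    by apply/funext => x /=; rewrite class_reprK.
  rewrite vE -(hom_eval to_class_hom); apply/filt_to_class; apply: mM CG _ _.
  move=> psi /GF Fpsi; apply/filt_to_class.
  by rewrite (hom_eval to_class_hom) -vE.
move=> p q; split=> [pq|->]; last exact: leibniz_refl.
rewrite -[p]class_reprK -[q]class_reprK; apply/eq_to_class.
have FE : filt M = to_class @^-1` filt leibniz_quotient.
  by apply/seteqP; split=> a /= /filt_to_class.
rewrite /R FE; apply: (leibniz_preim to_class_hom).
by rewrite !class_reprK.
Qed.

End LeibnizQuotient.

(* The consequences of [is_partition_function] that the decomposition into
   fibers uses; the last two say that the fiber of [op a] is the join of the
   fibers of the arguments. *)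
Record plonka_function (L : language) (A : algebra L) (dot : A -> A -> A) : Prop := {
  dotxx : forall a, dot a a = a;
  dotA : forall a b c, dot a (dot b c) = dot (dot a b) c;
  dotAC : forall a b c, dot (dot a b) c = dot (dot a c) b;
  dot_opl : forall (g : symbol L) (a : 'I_(arity g) -> A) b,
    dot (op a) b = op (fun k => dot (a k) b);
  dot_op_arg : forall (g : symbol L) (a : 'I_(arity g) -> A) k,
    dot (op a) (a k) = op a;
  dot_opr : forall (g : symbol L) (a : 'I_(arity g) -> A) b,
    (forall k, dot b (a k) = b) -> dot b (op a) = b
}.

Lemma partition_plonka (L : language) (A : algebra L) (dot : A -> A -> A) :
  is_partition_function dot -> plonka_function dot.
Proof.
move=> [xx assoc comm opl opr].
have AC a b c : dot (dot a b) c = dot (dot a c) b by rewrite -assoc comm assoc.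
have foldl_dot s y b : foldl dot (dot y b) s = dot (foldl dot y s) b.
  by elim: s y => //= c s IH y; rewrite AC IH.
split=> // g a => [k|b ba]; last first.
  by rewrite opr; elim: (enum _) => //= k s IH; rewrite ba.
(* Expand [op a . op a] into [op a . a_1 ... a_n]: the factor [a k] moves next to its own occurrence
   and is absorbed. *)
rewrite -[op a]xx [dot (op a) (op a)]opr.
have: k \in enum 'I_(arity g) by rewrite mem_enum.
elim: (enum _) (op a) => //= l s IH y; rewrite inE => /orP[/eqP <-|/IH -> //].
by rewrite foldl_dot -assoc xx.
Qed.

(** * Calculus of partition functions *)

Section PlonkaFunction.
Variables (L : language) (A : algebra L) (dot : A -> A -> A).
Hypothesis P : plonka_function dot.

Lemma dotKl a b : dot (dot a b) b = dot a b.
Proof. by rewrite -(dotA P) (dotxx P). Qed.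

(** With [dot a b = a] read as [a] lying in a fiber above that of [b], this is transitivity. *)
Lemma dot_le_trans a b c : dot a b = a -> dot b c = b -> dot a c = a.
Proof. by move=> ab bc; rewrite -ab -(dotA P) bc. Qed.

Lemma eval_dotl (v : nat -> A) b phi :
  dot (eval v phi) b = eval (fun x => dot (v x) b) phi.
Proof.
elim: phi => [//|g ts IH] /=; rewrite (dot_opl P).
by congr op; apply/funext.
Qed.

Lemma eval_dot_var (v : nat -> A) x phi :
  vars phi x -> dot (eval v phi) (v x) = eval v phi.
Proof.
elim: phi => [y -> |g ts IH [k _ xk]] /=; first exact: dotxx.
exact: dot_le_trans (dot_op_arg P _ k) (IH k xk).
Qed.

(** One variable of [phi] already absorbs [b], hence so does the whole value; multiplying all the
    other variables by [b] then changes nothing. *)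
Lemma eval_dot_some (v w : nat -> A) b phi :
    (forall x, w x = v x \/ w x = dot (v x) b) ->
    (exists2 x, vars phi x & w x = dot (v x) b) ->
  eval w phi = dot (eval v phi) b.
Proof.
move=> wv [x phix wx]; transitivity (dot (eval w phi) b).
  apply/esym/(@dot_le_trans _ (w x)); first exact: eval_dot_var.
  by rewrite wx dotKl.
rewrite !eval_dotl; apply: eq_eval => y _.
by case: (wv y) => ->; rewrite ?dotKl.
Qed.

End PlonkaFunction.

Lemma ModStar_Alg (L : language) (C : conseq L) (M : lmatrix L) : ModStar C M -> Alg C M.
Proof.
move=> [mM redM]; exists (filt M); split=> // a b; split=> [ab|->].
  by apply/redM; apply: ab.
by move=> G _ _; exact: leibniz_refl.
Qed.

(** This Lindenbaum matrix turns Leibniz congruence of formulas into derivability. *)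
Lemma theory_model (L : language) (C : conseq L) (G : set (formula L)) :
  is_logic C -> is_model C (@LMatrix L (Fm L) (C G)).
Proof.
move=> [_ Ccut Csub]; apply/modelP => D phi CD v GD.
apply: Ccut (Csub _ (@eval_hom _ _ v) _ _ CD) => _ [psi Dpsi <-].
exact: GD.
Qed.

(* A regular identity valid up to the Leibniz congruence in the models of [C]
   yields interderivable formulas with the same variables when it is plugged
   into a context, so the left variable inclusion companion cannot separate
   its two sides. *)
Lemma regular_identity (L : language) (C : conseq L) (alpha beta : formula L) :
    is_logic C -> vars alpha = vars beta ->
    (forall (M : lmatrix L) (v : nat -> M), is_model C M ->
       leibniz (filt M) (eval v alpha) (eval v beta)) ->
  forall M : lmatrix L, ModSu (left_companion C) M ->
  forall v : nat -> M, eval v alpha = eval v beta.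
Proof.
move=> C_logic varsE idE M [_ redM] v; apply/redM => G mG _.
(* Even variables carry those of [gamma] and odd ones the parameters of [phi], so that the two
   cannot clash. *)
pose s gamma x : Fm L :=
  if x == 0%N then eval (fun y => Var y.*2 : Fm L) gamma else Var x.*2.+1.
apply: leibniz_polynomial => phi w.
pose u y : M := if odd y then w y./2 else v y./2.
have E gamma : eval (fun x => if x == 0%N then eval v gamma else w x) phi =
    eval u (eval (s gamma) phi).
  rewrite eval_subst; apply: eq_eval => x _ /=; rewrite /s; case: ifP => _.
    rewrite eval_subst; apply: eq_eval => y _ /=.
    by rewrite /u odd_double doubleK.
  by rewrite /= /u /= odd_double /= uphalf_double.
rewrite !E.
suff H (al be : formula L) : vars al = vars be ->
    (forall (M : lmatrix L) (v : nat -> M), is_model C M ->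
       leibniz (filt M) (eval v al) (eval v be)) ->
    G (eval u (eval (s al) phi)) -> G (eval u (eval (s be) phi)).
  split; apply: H => // N z mN; exact/leibniz_sym/idE.
move=> {E}varsE' idE' Gal.
(* In the Lindenbaum matrix of [T] the two instances are Leibniz congruent, so the second follows
   from the first. *)
pose T : set (formula L) := C [set eval (s al) phi].
have CT : C [set eval (s al) phi] (eval (s be) phi).
  have [C1 _ _] := C_logic.
  have mT := @theory_model L C [set eval (s al) phi] C_logic.
  apply: (@leibniz_filt L (Fm L) T (eval (s al) phi)); last exact: C1.
  apply: congruence_eval; first exact: leibniz_congruence.
  move=> x _; rewrite /s; case: ifP => _; last exact: leibniz_refl.
  exact: (idE' (@LMatrix L (Fm L) T) (fun y => Var y.*2) mT).
move/modelP: mG => /(_ [set eval (s al) phi]); apply; last by move=> _ ->; exact: Gal.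
exists [set eval (s al) phi]; split=> //.
rewrite bigcup_set1 !vars_subst => y [x phix xy]; exists x => //.
by move: xy; rewrite /s; case: ifP => // _; rewrite !vars_subst varsE'.
Qed.

(** * The partition function in models of the logic and of its companion *)

Section PartitionLogic.
Variables (L : language) (C : conseq L) (t : formula L) (Delta : set (formula L)).
Hypothesis C_logic : is_logic C.
Hypothesis tE : vars t = [set 0%N; 1%N].
Hypothesis Ct : C [set Var 0] t.
Hypothesis t_partition : forall A : algebra L, Alg C A -> is_partition_function (@eval2 L A t).
Hypothesis Delta_leibniz : forall M : lmatrix L, is_model C M -> forall a b : M,
  leibniz (filt M) a b <-> [set eval2 delta a b | delta in Delta] `<=` filt M.

Lemma filt_dot M : is_model C M -> forall a b : M, filt M a -> filt M (eval2 t a b).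
Proof.
move=> /modelP mM a b Fa; apply: mM Ct _ _ => _ ->; exact: Fa.
Qed.

(** The rule from [x] to [x . y] survives in the companion because [x] occurs in [t]. *)
Lemma filt_dot_left M : is_model (left_companion C) M ->
  forall a b : M, filt M a -> filt M (eval2 t a b).
Proof.
move=> /modelP mM a b Fa; apply: (mM [set Var 0]); last by move=> _ ->; exact: Fa.
by exists [set Var 0]; split=> //; rewrite bigcup_set1 tE => x ->; left.
Qed.

Lemma ModStar_dot M : ModStar C M -> forall a b : M, eval2 t a b = a.
Proof.
move=> redM a b; have P := partition_plonka (t_partition (ModStar_Alg redM)).
case: redM => mM redM; apply/redM/Delta_leibniz => // _ [delta Dd <-].
have Faa : filt M (eval2 delta a a).
  by have /(Delta_leibniz mM) := leibniz_refl (filt M) a; apply; exists delta.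
have [d0|d0] := pselect (vars delta 0%N); last first.
  rewrite /eval2; erewrite eq_eval; first exact: Faa.
  by move=> [|x] // /d0.
rewrite /eval2 (eval_dot_some P (v := fun x => if x == 0%N then a else a) (b := b)).
- exact: filt_dot.
- by move=> [|x] /=; [right|left].
- by exists 0%N.
Qed.

Lemma model_dot M : is_model C M -> forall a b : M, leibniz (filt M) (eval2 t a b) a.
Proof.
move=> mM a b; apply/eq_to_class.
rewrite (hom_eval2 t a b (@to_class_hom L M)).
exact: ModStar_dot (leibniz_quotient_ModStar mM) _ _.
Qed.

(** Each unconditional clause is a regular identity that holds in models of [C] once right factors
    are dropped ([lft], [lft2]). The conditional one is derived from two such identities. *)
Lemma plonka_function_left M :
  ModSu (left_companion C) M -> plonka_function (@eval2 L M t).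
Proof.
move=> suM; pose dot (p q : formula L) : formula L := eval2 (A := Fm L) t p q.
have dotE (A : algebra L) (v : nat -> A) p q :
  eval v (dot p q) = eval2 t (eval v p) (eval v q) by exact: eval_eval2.
have varsE p q : vars (dot p q) = vars p `|` vars q by exact: vars_eval2.
have lft (N : lmatrix L) (v : nat -> N) p q r : is_model C N ->
    leibniz (filt N) (eval v p) (eval v r) ->
    leibniz (filt N) (eval v (dot p q)) (eval v r).
  move=> mN pr; rewrite dotE; apply: leibniz_trans pr; exact: model_dot.
have lft2 (N : lmatrix L) (v : nat -> N) p q r : is_model C N ->
    leibniz (filt N) (eval v r) (eval v p) ->
    leibniz (filt N) (eval v r) (eval v (dot p q)).
  move=> mN pr; apply: leibniz_sym; apply: (lft) => //; exact: leibniz_sym.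
have reg al be : vars al = vars be ->
    (forall (N : lmatrix L) (v : nat -> N), is_model C N ->
       leibniz (filt N) (eval v al) (eval v be)) ->
    forall v : nat -> M, eval v al = eval v be.
  by move=> vE idE; apply: regular_identity suM.
have refl (N : lmatrix L) (a : N) := leibniz_refl (filt N) a.
(* Variables below [n] stand for the arguments of the operation, and all later ones, in particular
   [Var n], for [b]. *)
pose val n (a : 'I_n -> M) b m := if insub m is Some k then a k else b.
have valE n (a : 'I_n -> M) b (k : 'I_n) : val n a b k = a k by rewrite /val valK.
have valN n (a : 'I_n -> M) b : val n a b n = b by rewrite /val insubN // ltnn.
split.
- move=> a; have := reg (dot (Var 0) (Var 0)) (Var 0) _ _ (fun=> a).
  rewrite dotE; apply; first by rewrite varsE setUid.
  by move=> N v mN; apply: (lft).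
- move=> a b c.
  have := reg (dot (Var 0) (dot (Var 1) (Var 2))) (dot (dot (Var 0) (Var 1)) (Var 2))
    _ _ (nth a [:: a; b; c]).
  rewrite !dotE; apply; first by rewrite !varsE setUA.
  by move=> N v mN; apply: (lft) => //; apply: (lft2) => //; apply: (lft2).
- move=> a b c.
  have := reg (dot (dot (Var 0) (Var 1)) (Var 2)) (dot (dot (Var 0) (Var 2)) (Var 1))
    _ _ (nth a [:: a; b; c]).
  rewrite !dotE; apply; first by rewrite !varsE setUAC.
  by move=> N v mN; do 2 apply: (lft) => //; do 2 apply: (lft2) => //.
- move=> g a b; pose n := arity g.
  have := reg (dot (App (fun k : 'I_n => Var k)) (Var n))
    (App (fun k : 'I_n => dot (Var k) (Var n))) _ _ (val n a b).
  rewrite dotE /= valN.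
  have -> : (fun k : 'I_n => val n a b k) = a by apply/funext => k; exact: valE.
  have -> : (fun k : 'I_n => eval (val n a b) (dot (Var k) (Var n))) =
      (fun k => eval2 t (a k) b).
    by apply/funext => k; rewrite dotE /= valE valN.
  apply.
    rewrite varsE; apply/seteqP; split=> x /=.
      move=> [[k _ ->]|->]; first by exists k => //; rewrite varsE; left.
      by exists (Ordinal (arity_gt0 g)) => //; rewrite varsE; right.
    by move=> [k _]; rewrite varsE => -[->|->]; [left; exists k|right].
  move=> N v mN.
  apply: (lft N v _ _ (App (fun k : 'I_n => dot (Var k) (Var n)))) => //=.
  have [_ opR] := leibniz_congruence (filt N); apply: opR => k.
  by apply: (lft2 _ _ (Var k) _ (Var k)).
- move=> g a k; pose n := arity g.
  have := reg (dot (App (fun k : 'I_n => Var k)) (Var k)) (App (fun k : 'I_n => Var k))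
    _ _ (val n a (a k)).
  rewrite dotE /= valE.
  have -> : (fun l : 'I_n => val n a (a k) l) = a by apply/funext => l; exact: valE.
  apply; last by move=> N v mN; apply: (lft N v _ _ (App (fun k : 'I_n => Var k))).
  by rewrite varsE; apply/setUidPl => _ ->; exists k.
- move=> g a b ba; pose n := arity g.
  (* The hypothesis on [b] turns [b . g(b . a_1, ..., b . a_n)] into [b . g(b, ..., b)], which a
     one-variable identity reduces to [b]. *)
  have := reg (dot (Var n) (App (fun k : 'I_n => Var k)))
    (dot (Var n) (App (fun k : 'I_n => dot (Var n) (Var k)))) _ _ (val n a b).
  rewrite !dotE /= valN.
  have -> : (fun k : 'I_n => val n a b k) = a by apply/funext => k; exact: valE.
  have -> : (fun k : 'I_n => eval (val n a b) (dot (Var n) (Var k))) = (fun=> b).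
    by apply/funext => k; rewrite dotE /= valE valN.
  move=> ->; last first.
  + by move=> N v mN; apply: (lft) => //; apply: (lft2).
  + rewrite !varsE; apply/seteqP; split=> x /=.
      move=> [->|[k _ ->]]; first by left.
      by right; exists k => //; rewrite varsE; right.
    move=> [->|[k _]]; first by left.
    by rewrite varsE => -[->|->]; [left|right; exists k].
  have := reg (dot (Var 0) (App (fun k : 'I_n => Var 0))) (Var 0) _ _ (fun=> b).
  rewrite !dotE /=; apply; last by move=> N v mN; apply: (lft N v _ _ (Var 0)).
  by rewrite varsE; apply/setUidPl => x [k _].
Qed.

End PartitionLogic.

(** * Invariance under isomorphism *)

Section MatrixIsomorphism.
Variable L : language.

Lemma bij_hom_inv (A B : algebra L) (h : A -> B) (k : B -> A) :
  is_hom h -> cancel h k -> cancel k h -> is_hom k.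
Proof.
move=> hom_h hK kH g b; apply: (can_inj hK); rewrite kH hom_h; congr op.
by apply/funext => l /=; rewrite kH.
Qed.

Lemma matrix_iso_sym (M N : lmatrix L) : matrix_iso M N -> matrix_iso N M.
Proof.
move=> [h [hom_h [k hK kH] Fh]]; exists k; split.
- exact: bij_hom_inv hom_h hK kH.
- by exists h.
- by move=> b; rewrite Fh kH.
Qed.

Lemma model_preim (C : conseq L) (A B : algebra L) (h : A -> B) (G : set B) :
  is_hom h -> is_filter C G -> is_filter C (h @^-1` G).
Proof.
move=> hom_h /modelP mG; apply/modelP => D phi CD v GD.
rewrite /= (hom_eval hom_h); apply: mG CD _ _ => psi /GD.
by rewrite /= (hom_eval hom_h).
Qed.

(** Filters pull back along the isomorphism, and Leibniz congruences along its inverse. *)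
Lemma matrix_iso_ModSu (C : conseq L) (M N : lmatrix L) :
  matrix_iso M N -> ModSu C N -> ModSu C M.
Proof.
move=> [h [hom_h [k hK kH] Fh]] [mN suN].
have FE : filt M = h @^-1` filt N by apply/seteqP; split=> a /Fh.
split.
  have := model_preim hom_h (G := filt N) mN; rewrite -FE.
  by apply.
move=> a b; split=> [ab|->]; last by move=> G _ _; exact: leibniz_refl.
apply: (can_inj hK); apply/suN => G mG FG.
have GE : G = k @^-1` (h @^-1` G) by apply/seteqP; split=> x /=; rewrite kH.
rewrite GE; apply: (leibniz_preim (bij_hom_inv hom_h hK kH)).
rewrite !hK; apply: ab; first exact: model_preim.
by rewrite FE => x; exact: FG.
Qed.

End MatrixIsomorphism.

(** * Evaluation and filters in a Plonka sum *)

Section PlonkaSumTheory.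
Variables (L : language) (d : Order.disp_t) (I : joinSemilatticeType d).
Variable X : directed_system L I.
Notation PL := (plonka_algebra X).
Notation inj i x := (existT (fun l : I => X l) i x : PL).

(** By antisymmetry the map is an identity; stating this with two inequalities avoids casts between
    fibers. *)
Lemma inj_trans_map (a : PL) j (aj : (tag a <= j)%O) :
  (j <= tag a)%O -> a = inj j (trans_map aj (tagged a)).
Proof.
case: a aj => i x /= ij ji; have ijE : i = j by apply/le_anti; rewrite ij.
by case: j / ijE ij {ji} => ii; rewrite trans_map_id.
Qed.

Lemma plonka_eval_trans (v : nat -> PL) j (g : nat -> X j) phi :
    (forall x, vars phi x ->
       exists xj : (tag (v x) <= j)%O, g x = trans_map xj (tagged (v x))) ->
  exists pj : (tag (eval v phi) <= j)%O,
    trans_map pj (tagged (eval v phi)) = eval g phi.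
Proof.
elim: phi => [x|c ts IH] /= vg; first by have [xj ->] := vg x erefl; exists xj.
have IHk k := IH k (fun x xk => vg x (ex_intro2 _ _ k Logic.I xk)).
have le_j : (join_fam (arity_gt0 c) (fun k => tag (eval v (ts k))) <= j)%O.
  by apply: join_fam_le => k; have [kj _] := IHk k.
exists le_j; rewrite trans_map_hom; congr op; apply/funext => k /=.
by have [kj <-] := IHk k; rewrite -trans_map_comp.
Qed.

Lemma le_tag_eval (v : nat -> PL) phi x :
  vars phi x -> (tag (v x) <= tag (eval v phi))%O.
Proof.
elim: phi => [y -> //|g ts IH [k _ xk]] /=.
apply: le_trans (IH k xk) _.
exact: (le_join_fam (arity_gt0 g) (fun k => tag (eval v (ts k)))).
Qed.

Lemma plonka_eval_fiber i (g : nat -> X i) phi :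
  eval (fun x => inj i (g x)) phi = inj i (eval g phi).
Proof.
have [|pi <-] := @plonka_eval_trans (fun x => inj i (g x)) i g phi.
  by move=> x _; exists (lexx i); rewrite trans_map_id.
apply: inj_trans_map; have [x phix] := vars_nonempty phi.
exact: (le_tag_eval (fun x => inj i (g x)) phix).
Qed.

Lemma plonka_eval2_fiber (p : formula L) i (x y : X i) :
  eval2 p (inj i x) (inj i y) = inj i (eval2 p x y).
Proof.
rewrite -plonka_eval_fiber; apply: eq_eval => z _; by case: ifP.
Qed.

(** The premises used by the companion have their variables in the conclusion, so the whole
    inference can be moved into the fiber of the conclusion. *)
Lemma plonka_filter (C : conseq L) (G : set PL) :
    (forall i, is_model C (LMatrix [set x : X i | G (inj i x)])) ->
    (forall i j (ij : (i <= j)%O) x, G (inj i x) -> G (inj j (trans_map ij x))) ->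
  is_filter (left_companion C) G.
Proof.
move=> mG Gtrans; apply/modelP => D phi [E [ED varsE CE]] v GD.
pose j := tag (eval v phi).
have xj x : vars phi x -> (tag (v x) <= j)%O by exact: le_tag_eval.
have [z _] := vars_nonempty phi.
(* The default is reached only by variables outside [phi], and the premises in [E] contain none of
   these. *)
pose g x : X j := match pselect (tag (v x) <= j)%O with
  | left le_xj => trans_map le_xj (tagged (v x)) | right _ => tagged (eval v phi) end.
have gE x : vars phi x ->
    exists le_xj : (tag (v x) <= j)%O, g x = trans_map le_xj (tagged (v x)).
  by move=> /xj le_xj; rewrite /g; case: pselect => // le'; exists le'.
have [pj phiE] := plonka_eval_trans gE.
rewrite (inj_trans_map pj (lexx j)) phiE.
have /modelP mj := mG j; apply: (mj _ _ CE g) => psi Epsi /=.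
have [|psij <-] := @plonka_eval_trans v j g psi.
  by move=> x psix; apply: gE; apply: varsE; exists psi.
by apply: Gtrans; case: (eval v psi) (GD _ (ED _ Epsi)).
Qed.

End PlonkaSumTheory.

(** * Plonka sums of reduced models are Suszko-reduced *)

Section ReducedPlonkaSum.
Variables (L : language) (C : conseq L) (t : formula L) (Delta : set (formula L)).
Hypothesis tE : vars t = [set 0%N; 1%N].
Hypothesis Delta_leibniz : forall M : lmatrix L, is_model C M -> forall a b : M,
  leibniz (filt M) a b <-> [set eval2 delta a b | delta in Delta] `<=` filt M.
Variables (d : Order.disp_t) (I : joinSemilatticeType d).
Variable X : directed_system L I.
Hypothesis redX : forall i, ModStar C (X i).
Hypothesis t_proj : forall i (a b : X i), eval2 t a b = a.
Notation PL := (plonka_algebra X).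
Notation inj i x := (existT (fun l : I => X l) i x : PL).

(** As [t] is the first projection in every fiber, [a . b] is the image of [a] in the join of the
    two fibers. *)
Lemma plonka_dot (a b : PL) :
  [/\ (exists aj : (tag a <= tag (eval2 t a b))%O,
        eval2 t a b = inj (tag (eval2 t a b)) (trans_map aj (tagged a))),
      (tag b <= tag (eval2 t a b))%O
    & forall j, (tag a <= j)%O -> (tag b <= j)%O -> (tag (eval2 t a b) <= j)%O].
Proof.
pose v x := if x == 0%N then a else b.
have a_le : (tag a <= tag (eval2 t a b))%O.
  by apply: (@le_tag_eval _ _ _ X v t 0); rewrite tE; left.
have b_le : (tag b <= tag (eval2 t a b))%O.
  by apply: (@le_tag_eval _ _ _ X v t 1); rewrite tE; right.
have ub j (aj : (tag a <= j)%O) (bj : (tag b <= j)%O) :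
    exists abj : (tag (eval2 t a b) <= j)%O,
      trans_map abj (tagged (eval2 t a b)) = trans_map aj (tagged a).
  have [|abj abE] := @plonka_eval_trans _ _ _ X v j
      (fun x => if x == 0%N then trans_map aj (tagged a) else trans_map bj (tagged b)) t.
    by move=> x _; rewrite /v; case: ifP => _; [exists aj|exists bj].
  by exists abj; rewrite abE; exact: t_proj.
split=> //.
  exists a_le; have [le abE] := ub _ a_le b_le.
  by rewrite -abE; exact: inj_trans_map.
by move=> j aj bj; have [] := ub j aj bj.
Qed.

Lemma plonka_sum_model : is_model (left_companion C) (plonka_sum X).
Proof.
apply: (@plonka_filter _ _ _ X C (filt (plonka_sum X))) => [i|i j ij x /= Fx].
  by case: (redX i).
by apply: (@trans_map_filt _ _ _ X i j ij); exists x.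
Qed.

Lemma plonka_suszko_fiber i (x y : X i) :
  suszko (left_companion C) (filt (plonka_sum X)) (inj i x) (inj i y) -> x = y.
Proof.
move=> xy; have [mi redi] := redX i; apply/redi/(Delta_leibniz mi) => _ [delta Dd <-].
have /(Delta_leibniz mi) Dxx := leibniz_refl (filt (X i)) x.
have Fxx : filt (X i) (eval2 delta x x) by apply: Dxx; exists delta.
have lxy := xy _ plonka_sum_model (@subset_refl _ _).
have : filt (plonka_sum X) (eval2 delta (inj i x) (inj i y)).
  apply: (@leibniz_filt _ _ _ (eval2 delta (inj i x) (inj i x))).
    apply: congruence_eval; first exact: leibniz_congruence.
    by move=> z _; case: ifP => // _; exact: leibniz_refl.
  by rewrite plonka_eval2_fiber.
by rewrite plonka_eval2_fiber.
Qed.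

Hypothesis trivial_below : forall n i : I, trivial_matrix (X n) -> (n < i)%O ->
  exists j : I, [/\ (n <= j)%O, ~~ (i <= j)%O & nontrivial_algebra (X j)].

(* Enlarging [F] by all fibers above [k] keeps it a filter; an element outside
   [F] in a fiber that is above [n] but not above [k] then separates [x] from
   its image in the fiber [k]. *)
Lemma plonka_suszko_up n k (nk : (n <= k)%O) (x : X n) :
  suszko (left_companion C) (filt (plonka_sum X)) (inj n x) (inj k (trans_map nk x)) ->
  (k <= n)%O.
Proof.
move=> xk; apply: contrapT => /negP kn.
have ltnk : (n < k)%O by rewrite lt_leAnge nk.
(* If the matrix [n] is not trivial, [n] itself serves as [j]; otherwise a non-trivial reduced fiber
   cannot have the full filter. *)
have [j [nj kj [z Fz]]] : exists j, [/\ (n <= j)%O, ~~ (k <= j)%O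
    & exists z : X j, ~ filt (X j) z].
  have [nT|nT] := pselect (trivial_matrix (X n)); last first.
    exists n; split=> //; apply: contrapT => /forallNP Fn; apply: nT.
    by apply/seteqP; split=> // z _; exact: contrapT (Fn z).
  have [j [nj kj [y [z yz]]]] := trivial_below nT ltnk.
  exists j; split=> //; apply: contrapT => /forallNP Fj; apply: yz.
  apply: (ModStar_trivial (redX j)).
  by apply/seteqP; split=> // u _; exact: contrapT (Fj u).
pose G : set PL := [set u | filt (plonka_sum X) u \/ (k <= tag u)%O].
have mG : is_filter (left_companion C) G.
  apply: plonka_filter => [i|i l il y [Fy|ki]]; last first.
  - by right; exact: le_trans ki il.
  - by left; apply: (@trans_map_filt _ _ _ X i l il); exists y.
  have [mi _] := redX i; move/modelP: mi => mi; apply/modelP => D phi CD v FD /=.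
  have [ki|ki] := boolP (k <= i)%O; first by right.
  left; apply: mi CD _ _ => psi /FD [//|/=].
  by rewrite (negPf ki).
have lG := xk _ mG (fun u Fu => or_introl Fu).
(* The product of [z] with the image of [x] lies above [k], hence in [G], whereas [z . x] is [z]
   because [n <= j]. *)
have : G (eval2 t (inj j z) (inj n x)).
  apply: (@leibniz_filt _ _ _ (eval2 t (inj j z) (inj k (trans_map nk x)))).
    apply: congruence_eval; first exact: leibniz_congruence.
    move=> u _; case: ifP => // _; first exact: leibniz_refl.
    exact: leibniz_sym.
  by right; have [_ + _] := plonka_dot (inj j z) (inj k (trans_map nk x)).
have [[jj ->] _ ub] := plonka_dot (inj j z) (inj n x).
rewrite -inj_trans_map /=; last exact: ub.
by case=> //=; rewrite (negPf kj).
Qed.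

Lemma plonka_sum_ModSu : ModSu (left_companion C) (plonka_sum X).
Proof.
split; first exact: plonka_sum_model.
move=> a b; split=> [ab|->]; last by move=> G _ _; exact: leibniz_refl.
have ba : suszko (left_companion C) (filt (plonka_sum X)) b a.
  by move=> G mG FG; exact/leibniz_sym/ab.
have le (u w : PL) :
    suszko (left_companion C) (filt (plonka_sum X)) u w -> (tag w <= tag u)%O.
  (* Replacing [w] by [u . w], the image of [u] in the join, reduces to the case of an element and
     its image. *)
  move=> uw; have uuw : suszko (left_companion C) (filt (plonka_sum X)) u (eval2 t u w).
    have {1}-> : u = eval2 t u u.
      by case: (u) => i x; rewrite plonka_eval2_fiber t_proj.
    move=> G mG FG; apply: congruence_eval; first exact: leibniz_congruence.
    by move=> z _; case: ifP => _; [exact: leibniz_refl|exact: uw].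
  have [[uj uE] wj _] := plonka_dot u w.
  apply: le_trans wj _; apply: (@plonka_suszko_up _ _ uj (tagged u)).
  by rewrite -uE; case: (u) uuw.
have tab : tag a = tag b by apply/le_anti; rewrite (le _ _ ab) (le _ _ ba).
case: a b tab ab {ba} => i x [j y] /= ijE; case: j / ijE y => y xy.
by rewrite (plonka_suszko_fiber xy).
Qed.

End ReducedPlonkaSum.

(** * Decomposition of an algebra into fibers *)

(* The fiber of [a] is encoded by the set of the elements lying in a fiber
   above it, so that the order on fibers is reverse inclusion and the join is
   the intersection. *)
Section FiberIndex.
Variables (L : language) (A : algebra L) (dot : A -> A -> A).

Definition above (a : A) : set A := [set x | dot x a = x].

Definition fiber_index (P : plonka_function dot) : Type :=
  {p : set A | exists a, p = above a}.

Variable P : plonka_function dot.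
Notation I := (fiber_index P).

Definition fiber_of (a : A) : I := exist _ (above a) (ex_intro _ a erefl).

Definition fiber_repr (i : I) : A := sval (cid (svalP i)).

Lemma fiber_index_inj (i j : I) : sval i = sval j -> i = j.
Proof. by case: i j => p pP [q qP] /= pq; exact: eq_exist. Qed.

Lemma fiber_reprK i : fiber_of (fiber_repr i) = i.
Proof. by apply: fiber_index_inj; rewrite /= -(svalP (cid (svalP i))). Qed.

Definition index_le (i j : I) : bool := `[< sval j `<=` sval i >].

Fact index_le_refl : reflexive index_le.
Proof. by move=> i; apply/asboolP. Qed.

Fact index_le_anti : antisymmetric index_le.
Proof.
move=> i j /andP[/asboolP ij /asboolP ji].
by apply: fiber_index_inj; apply/seteqP; split.
Qed.

Fact index_le_trans : transitive index_le.
Proof.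
by move=> j i k /asboolP ij /asboolP jk; apply/asboolP; exact: subset_trans ij.
Qed.

Fact index_join_proof (i j : I) : exists a, sval i `&` sval j = above a.
Proof.
have [[a ->] [b ->]] := (svalP i, svalP j); exists (dot a b).
apply/seteqP; split=> x; rewrite /above /=.
  by move=> [xa xb]; rewrite (dotA P) xa xb.
rewrite (dotA P) => xab; split; rewrite -xab; last exact: dotKl.
by rewrite (dotAC P) dotKl.
Qed.

Definition index_join (i j : I) : I := exist _ _ (index_join_proof i j).

Fact index_leUx i j k : index_le (index_join i j) k = index_le i k && index_le j k.
Proof.
apply/asboolP/andP => [kij|[/asboolP ik /asboolP jk] x kx].
  by split; apply/asboolP => x /kij[].
by split; [exact: ik|exact: jk].
Qed.

HB.instance Definition _ := gen_eqMixin I.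
HB.instance Definition _ := gen_choiceMixin I.
HB.instance Definition _ :=
  Order.Le_isPOrder.Build (Order.Disp tt tt) I index_le_refl index_le_anti index_le_trans.
HB.instance Definition _ :=
  Order.POrder_isJoinSemilattice.Build (Order.Disp tt tt) I index_leUx.

Lemma fiber_of_le a b : (fiber_of a <= fiber_of b)%O <-> dot b a = b.
Proof.
split=> [/asboolP|ba]; first by apply; exact: dotxx.
by apply/asboolP => x /= xb; exact: dot_le_trans ba.
Qed.

Lemma fiber_of_eq a b : fiber_of a = fiber_of b <-> dot a b = a /\ dot b a = b.
Proof.
split=> [ab|[/fiber_of_le ba /fiber_of_le ab]]; last by apply/le_anti; rewrite ab.
by split; apply/fiber_of_le; rewrite ab.
Qed.

Lemma fiber_of_dot a b : (fiber_of a <= fiber_of b)%O -> fiber_of (dot a b) = fiber_of b.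
Proof.
move=> /fiber_of_le ba; apply/fiber_of_eq; rewrite dotKl //.
by rewrite (dotA P) ba (dotxx P).
Qed.

Lemma fiber_of_op (g : symbol L) (a : 'I_(arity g) -> A) i :
  (forall k, fiber_of (a k) = i) -> fiber_of (op a) = i.
Proof.
move=> ai; pose k := Ordinal (arity_gt0 g); rewrite -(ai k).
apply/fiber_of_eq; split; first exact: dot_op_arg.
apply: dot_opr => // l.
by have /fiber_of_eq[] : fiber_of (a k) = fiber_of (a l) by rewrite !ai.
Qed.

Definition fiber (i : I) : Type := {x : A | fiber_of x = i}.

Definition to_fiber (a : A) : fiber (fiber_of a) := exist _ a erefl.

Lemma fiber_inj i (x y : fiber i) : sval x = sval y -> x = y.
Proof. by case: x y => x xi [y yi] /= xy; exact: eq_exist. Qed.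

Definition fiber_op i (g : symbol L) (a : 'I_(arity g) -> fiber i) : fiber i :=
  exist _ (op (fun k => sval (a k))) (fiber_of_op (fun k => svalP (a k))).

Fact fiber_inhabited i : inhabited (fiber i).
Proof. by exists; exists (fiber_repr i); exact: fiber_reprK. Qed.

Definition fiber_algebra i : algebra L := Algebra (@fiber_op i) (fiber_inhabited i).

Definition fiber_matrix (G : set A) i : lmatrix L :=
  @LMatrix L (fiber_algebra i) [set x | G (sval x)].

Lemma fiber_val_hom i : is_hom (sval : fiber_algebra i -> A).
Proof. by []. Qed.

Lemma fiber_eval i (v : nat -> fiber_algebra i) phi :
  sval (eval v phi) = eval (fun x => sval (v x)) phi.
Proof. exact: (hom_eval (@fiber_val_hom i)). Qed.

Fact fiber_trans_proof i j (ij : (i <= j)%O) (x : fiber i) :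
  fiber_of (dot (sval x) (fiber_repr j)) = j.
Proof.
rewrite -[RHS]fiber_reprK; apply: fiber_of_dot.
by rewrite fiber_reprK (svalP x).
Qed.

(** Multiplying by any other element of the fiber [j] would give the same map. *)
Definition fiber_trans i j (ij : (i <= j)%O) (x : fiber i) : fiber j :=
  exist _ _ (fiber_trans_proof ij x).

Lemma dot_fiber i (x : A) : (i <= fiber_of x)%O -> dot x (fiber_repr i) = x.
Proof. by rewrite -[i in (i <= _)%O]fiber_reprK => /fiber_of_le. Qed.

Variable F : set A.
Hypothesis F_dot : forall a b, F a -> F (dot a b).

Definition fiber_system : directed_system L I.
Proof.
apply: (@DirectedSystem L _ I (fiber_matrix F) _ fiber_trans).
- by case: (carrier_inhabited A) => a; exists; exact: (fiber_of a).
- move=> i j ij g a; apply: fiber_inj => /=; exact: dot_opl.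
- by move=> i j ij _ [x Fx <-]; exact: F_dot.
- by move=> i ii x; apply: fiber_inj; apply: dot_fiber; rewrite (svalP x).
- move=> i j k ij jk ik x; apply: fiber_inj => /=.
  (* The factor from [j] is absorbed by the representative of [k], which lies above it. *)
  by rewrite (dotAC P) -(dotA P) [dot (fiber_repr k) _]dot_fiber // fiber_reprK.
Defined.

Lemma fiber_system_iso : matrix_iso (LMatrix F) (plonka_sum fiber_system).
Proof.
apply: matrix_iso_sym; exists (fun u : plonka_algebra fiber_system => sval (tagged u)).
split=> //; last first.
  exists (fun x => existT _ (fiber_of x) (to_fiber x)) => // -[i [x xi]] /=.
  by case: i / xi.
(* Multiplying every argument by the representative of the join multiplies the value, which already
   lies above the join. *)
move=> g a /=; rewrite -(dot_opl P); apply: dot_fiber.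
apply: join_fam_le => k; rewrite -(svalP (tagged (a k))).
by apply/fiber_of_le; exact: dot_op_arg.
Qed.

End FiberIndex.

(** * Filters and Leibniz congruences on the fibers *)

Section FiberModels.
Variables (L : language) (C : conseq L) (t : formula L) (Delta : set (formula L)).
Hypothesis C_logic : is_logic C.
Hypothesis C_finitary : finitary C.
Hypothesis tE : vars t = [set 0%N; 1%N].
Hypothesis Ct : C [set Var 0] t.
Hypothesis Delta_leibniz : forall M : lmatrix L, is_model C M -> forall a b : M,
  leibniz (filt M) a b <-> [set eval2 delta a b | delta in Delta] `<=` filt M.
Variable A : algebra L.
Notation dot := (@eval2 L A t).
Variable P : plonka_function dot.
Notation fiber_of := (fiber_of P).

Lemma conseq_dot (G : set (formula L)) (phi psi : formula L) :
  C G phi -> C G (eval2 (A := Fm L) t phi psi).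
Proof.
case: C_logic => C1 Ccut Csub CG; apply: (Ccut _ [set phi]); first by move=> _ ->.
have /Csub := @eval_hom L (Fm L) (fun x => if x == 0%N then phi else psi).
by move=> /(_ _ _ Ct); rewrite image_set1.
Qed.

(* By finitarity [phi] may be multiplied by all the variables of the premises,
   which makes the consequence one of the left variable inclusion companion;
   inside a fiber these factors change nothing. *)
Lemma fiber_model (G : set A) (i : fiber_index P) :
  is_filter (left_companion C) G -> is_model C (fiber_matrix G i).
Proof.
move=> /modelP mG; apply/modelP => D phi /C_finitary[E [Efin ED CE]] v GD.
have /finite_seqP[s sE] : finite_set (\bigcup_(psi in E) vars psi).
  by apply: bigcup_finite => // psi _; exact: finite_vars.
pose dots s := foldl (fun p x => eval2 (A := Fm L) t p (Var x)) phi s.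
have varsD r : vars (dots r) = vars phi `|` [set` r].
  rewrite /dots; elim/last_ind: r => [|r x IH].
    by rewrite /= set_nil setU0.
  rewrite foldl_rcons vars_eval2 // IH -setUA; congr setU.
  apply/seteqP; split=> y /=; rewrite mem_rcons inE.
    by move=> [->|->]; rewrite ?eqxx ?orbT.
  by move=> /predU1P[->|]; [right|left].
have CD r : C E (dots r).
  by rewrite /dots; elim/last_ind: r => [//|r x IH]; rewrite foldl_rcons; exact: conseq_dot.
pose u x := sval (v x).
have evalD r : eval u (dots r) = eval u phi.
  elim/last_ind: r => [//|r x IH].
  rewrite /dots foldl_rcons eval_eval2 -/(dots r) IH /u -fiber_eval /=.
  by have /fiber_of_eq[] : fiber_of (sval (eval v phi)) = fiber_of (sval (v x))
    by rewrite (svalP (eval v phi)) (svalP (v x)).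
rewrite /= fiber_eval -/u -(evalD s).
apply: (mG E); last by move=> psi /ED /GD /=; rewrite fiber_eval.
by exists E; split=> // x; rewrite sE varsD; right.
Qed.

Let deltas (G : set A) a b := [set eval2 delta a b | delta in Delta] `<=` G.

(** Fibers are subalgebras, so [Delta] may be evaluated in [A], free of membership proofs. *)
Lemma fiber_leibniz (G : set A) (i : fiber_index P) (x y : fiber i) :
    is_filter (left_companion C) G ->
  leibniz (filt (fiber_matrix G i)) x y <-> deltas G (sval x) (sval y).
Proof.
move=> /(@fiber_model G i) mi; rewrite (Delta_leibniz mi).
have E delta : sval (eval2 (A := fiber_algebra i) delta x y) = eval2 delta (sval x) (sval y).
  exact: hom_eval2 (@fiber_val_hom _ _ _ P i).
split=> xy _ [delta Dd <-]; last by rewrite /= E; apply: xy; exists delta.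
by rewrite -E; apply: (xy (eval2 (A := fiber_algebra i) delta x y)); exists delta.
Qed.

(** Right multiplication by [c] is an endomorphism of [A] that preserves [G]. *)
Lemma deltas_dot (G : set A) a b c : is_filter (left_companion C) G ->
  deltas G a b -> deltas G (dot a c) (dot b c).
Proof.
move=> mG ab _ [delta Dd <-].
have := filt_dot_left tE Ct mG c (ab _ (ex_intro2 _ _ delta Dd erefl)).
by rewrite /= (@hom_eval2 _ A A (dot ^~ c)) // => g x; exact: dot_opl.
Qed.

(* Within each fiber [R] below is the Leibniz congruence of [G], described by [Delta]. *)
Lemma deltas_leibniz (G : set A) a b : is_filter (left_companion C) G ->
  fiber_of a = fiber_of b -> deltas G a b -> leibniz G a b.
Proof.
move=> mG abE Dab; pose R c d := fiber_of c = fiber_of d /\ deltas G c d.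
have in_fiber c d (cd : fiber_of c = fiber_of d) : deltas G c d <->
    leibniz (filt (fiber_matrix G (fiber_of d))) (exist _ c cd) (to_fiber P d).
  by rewrite fiber_leibniz.
exists R; split=> //; last first.
  move=> c d [cd /(in_fiber _ _ cd)] /leibniz_filt; exact.
split; first split.
- by move=> c; split=> //; apply/(in_fiber _ _ erefl); exact: leibniz_refl.
- move=> c d [cd Dcd]; split=> //; apply/(fiber_leibniz (to_fiber P d) (exist _ c cd) mG).
  by apply/leibniz_sym/fiber_leibniz.
- move=> c d e [cd Dcd] [de Dde]; split; first by rewrite cd.
  apply/(fiber_leibniz (exist _ c (etrans cd de)) (to_fiber P e) mG).
  apply: (@leibniz_trans L (fiber_algebra (fiber_of e)) _ _ (exist _ d de)).
    exact/fiber_leibniz.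
  exact/fiber_leibniz.
move=> g c d cd; pose e := op c.
have le_fibers (x y : 'I_(arity g) -> A) : (forall k, fiber_of (x k) = fiber_of (y k)) ->
    (fiber_of (op x) <= fiber_of (op y))%O.
  move=> xy; apply/fiber_of_le; apply: (dot_opr P) => k.
  apply: (dot_le_trans P) (dot_op_arg P y k) _.
  by have /fiber_of_eq[] := xy k.
have cdE : fiber_of (op c) = fiber_of (op d).
  by apply/le_anti; rewrite !le_fibers // => k; have [] := cd k.
split=> //.
have ce k : (fiber_of (c k) <= fiber_of e)%O.
  by apply/fiber_of_le; exact: (dot_op_arg P).
have de k : (fiber_of (d k) <= fiber_of e)%O by have [<- _] := cd k.
(* The arguments may lie in different fibers; multiplied by [e] they all enter the fiber of [op c],
   and the values of the operation are unchanged. *)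
pose x k : fiber (fiber_of e) := exist _ (dot (c k) e) (fiber_of_dot (ce k)).
pose y k : fiber (fiber_of e) := exist _ (dot (d k) e) (fiber_of_dot (de k)).
have xy : leibniz (filt (fiber_matrix G (fiber_of e)))
    (@op L (fiber_algebra (fiber_of e)) g x) (@op L (fiber_algebra (fiber_of e)) g y).
  have [_ opR] := leibniz_congruence (filt (fiber_matrix G (fiber_of e))).
  by apply: opR => k; apply/fiber_leibniz => //=; apply: deltas_dot => //; have [] := cd k.
move: xy => /(fiber_leibniz _ _ mG) /=; rewrite -!(dot_opl P) (dotxx P).
by have /fiber_of_eq[_ ->] := cdE.
Qed.

Variable F : set A.
Hypothesis F_reduced : ModSu (left_companion C) (LMatrix F).

(** The values of [Delta] that lie in [F] lie in every larger filter, so elements congruent in a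
    fiber are Suszko congruent in [A]. *)
Lemma fiber_ModStar (i : fiber_index P) : ModStar C (fiber_matrix F i).
Proof.
have [mF suF] := F_reduced; split; first exact: fiber_model.
move=> x y; split=> [/(fiber_leibniz _ _ mF) xy|->]; last exact: leibniz_refl.
apply: fiber_inj; apply/suF => G mG FG; apply: deltas_leibniz => //.
  by rewrite (svalP x) (svalP y).
by move=> z /xy /FG.
Qed.

Let F_dot a b : F a -> F (dot a b).
Proof. by have [mF _] := F_reduced; exact: (filt_dot_left tE Ct mF). Qed.

(* If every fiber above [n] but not above [i] is trivial, the element [a] of the
   trivial matrix [n] is congruent to its image [dot a b] in the fiber [i] for
   every filter containing [F]. *)
Lemma fiber_trivial_below (n i : fiber_index P) :
    trivial_matrix (fiber_matrix F n) -> (n < i)%O ->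
  exists j : fiber_index P,
    [/\ (n <= j)%O, ~~ (i <= j)%O & nontrivial_algebra (fiber_matrix F j)].
Proof.
move=> nT ni; apply: contrapT => /forallNP noj.
have [mF suF] := F_reduced.
pose a := fiber_repr n; pose b := fiber_repr i.
have Fa : F a.
  have : filt (fiber_matrix F n) (exist _ a (fiber_reprK n)) by rewrite nT.
  by [].
suff aE : a = dot a b.
  suff : (i <= n)%O by rewrite (lt_geF ni).
  by rewrite -[i]fiber_reprK -[n]fiber_reprK; apply/fiber_of_le.
apply/suF => G mG FG.
have G_dot c d := filt_dot_left tE Ct mG (a := c) d.
(* [R] identifies elements above [n] that agree after multiplication by [b]. *)
pose R c d := c = d \/ [/\ dot c a = c, dot d a = d & dot c b = dot d b].
exists R; split; last by right; rewrite (dotxx P) (dotAC P) (dotxx P) dotKl.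
- split; first split.
  + by left.
  + by move=> c d [->|[? ? ?]]; [left|right].
  + move=> c d e [->//|[ca da cd]] [<-|[_ ea de]]; right; split=> //.
    by rewrite cd.
  move=> g c d cd.
  (* If some argument changes, it lies above [n], and so do both values of the operation. *)
  have [cdE|/existsNP[k ck]] := pselect (forall k, c k = d k).
    by left; congr op; apply/funext.
  have [//|[ca da _]] := cd k; right; split.
  + exact: (dot_le_trans P) (dot_op_arg P c k) ca.
  + exact: (dot_le_trans P) (dot_op_arg P d k) da.
  rewrite !(dot_opl P); congr op; apply/funext => l.
  by have [->|[_ _]] := cd l.
move=> c d [<- //|[_ da cdb]] Gc.
(* Above [i], [d] is [d . b], which equals [c . b] and lies in [G]. Elsewhere the fiber of [d] is
   trivial, so [d] is [a . d], which lies in [F]. *)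
have [id|id] := boolP (i <= fiber_of d)%O.
  have db : dot d b = d by exact: dot_fiber.
  by rewrite -db -cdb; exact: G_dot.
have nd : (n <= fiber_of d)%O by rewrite -[n]fiber_reprK; apply/fiber_of_le.
have ad : fiber_of (dot a d) = fiber_of d by apply: fiber_of_dot; rewrite fiber_reprK.
suff -> : d = dot a d by exact/FG/F_dot.
apply: contrapT => d_ad; apply: (noj (fiber_of d)); split=> //.
by exists (to_fiber P d), (exist (fun x => fiber_of x = _) _ ad) => /(congr1 sval).
Qed.

Lemma fiber_decomposition :
  exists (d : Order.disp_t) (I : joinSemilatticeType d) (X : directed_system L I),
    [/\ forall i : I, ModStar C (X i),
        matrix_iso (LMatrix F) (plonka_sum X)
      & forall n i : I, trivial_matrix (X n) -> (n < i)%O ->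
          exists j : I, [/\ (n <= j)%O, ~~ (i <= j)%O & nontrivial_algebra (X j)]].
Proof.
exists _, (fiber_index P : joinSemilatticeType _), (fiber_system P F_dot); split.
- exact: fiber_ModStar.
- exact: fiber_system_iso.
- exact: fiber_trivial_below.
Qed.

End FiberModels.

Theorem theorem5p5 (L : language) (C : conseq L) (C_logic : is_logic C)
    (C_equivalential : equivalential C) (C_finitary : finitary C)
    (C_partition : has_partition_function C) (M : lmatrix L) :
  ModSu (left_companion C) M <->
  exists (d : Order.disp_t) (I : joinSemilatticeType d) (X : directed_system L I),
    [/\ forall i : I, ModStar C (X i),
        matrix_iso M (plonka_sum X)
      & forall n i : I, trivial_matrix (X n) -> (n < i)%O ->
          exists j : I, [/\ (n <= j)%O, ~~ (i <= j)%O & nontrivial_algebra (X j)]].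
Proof.
case: C_equivalential => Delta [_ Delta_leibniz].
case: C_partition => t [tE Ct t_partition].
split=> [suM|[d [I [X [redX isoX trivX]]]]].
  have P := plonka_function_left C_logic tE Ct t_partition Delta_leibniz suM.
  case: M P suM => A F P suM.
  exact: (fiber_decomposition C_logic C_finitary tE Ct Delta_leibniz P suM).
apply: matrix_iso_ModSu isoX _.
apply: (plonka_sum_ModSu tE Delta_leibniz redX _ trivX) => i.
exact: (ModStar_dot Ct t_partition Delta_leibniz (redX i)).
Qed.
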